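(* Let $\mathcal{G}_k$ be the class of triangle-free graphs with circumference at most $k$. Then the chromatic number, the defective chromatic number and the clustered chromatic number of $\mathcal{G}_k$ are each in $\Omega(\sqrt{\log k})$ as $k\to\infty$; that is, there exist an absolute constant $c>0$ and an integer $k_0$ such that for all integers $k\geq k_0$ each of these three numbers is at least $c\sqrt{\log k}$.
   Context: Graphs are finite, simple and undirected. The circumference of a graph that is not a forest is the length of its longest cycle; the circumference of a forest is $2$. A $k$-colouring of a graph assigns one of at most $k$ colours to each vertex (not necessarily properly). A monochromatic component is a connected component of the subgraph induced by all vertices of a single colour. A colouring has defect $d$ if every monochromatic component has maximum degree at most $d$, and has clustering $c$ if every monochromatic component has at most $c$ vertices. For a graph class $\mathcal{G}$: the chromatic number of $\mathcal{G}$ is $\max\{\chi(G):G\in\mathcal{G}\}$, where $\chi(G)$ is the usual (proper) chromatic number; the defective chromatic number of $\mathcal{G}$ is the minimum integer $k$ for which there exists an integer $d$ such that every graph in $\mathcal{G}$ is $k$-colourable with defect $d$; the clustered chromatic number of $\mathcal{G}$ is the minimum integer $k$ for which there exists an integer $c$ such that every graph in $\mathcal{G}$ is $k$-colourable with clustering $c$. (Each is called unbounded if the relevant maximum or minimum does not exist.) *)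

(* Defs.v *)
From mathcomp Require Import all_boot all_order all_algebra.
From mathcomp Require Import all_classical all_reals all_analysis.

Set Implicit Arguments.
Unset Strict Implicit.
Unset Printing Implicit Defensive.

Import Order.TTheory GRing.Theory Num.Theory.

Record sgraph := SGraph {
  vertex :> finType;
  adj : rel vertex;
  adj_sym : symmetric adj;
  adj_irrefl : irreflexive adj }.

Arguments adj {s}.

Definition triangle_free (G : sgraph) : bool :=
  [forall x : G, forall y : G, forall z : G, ~~ [&& adj x y, adj y z & adj z x]].

(* [ucycleb] alone also accepts the empty sequence and the traversal [:: x; y]
   of a single edge, hence the bound 2 < n. *)
Definition has_cycle_of_length (G : sgraph) (n : nat) : bool :=
  (2 < n)%N && [exists c : n.-tuple G, ucycleb adj c].

(* A cycle has no repeated vertex, so only lengths up to #|G| can occur. *)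
Definition is_forest (G : sgraph) : bool :=
  [forall n : 'I_#|G|.+1, ~~ has_cycle_of_length G n].

Definition circumference (G : sgraph) : nat :=
  if is_forest G then 2%N
  else (\max_(n < #|G|.+1 | has_cycle_of_length G n) n)%N.

Definition properly_colourable (G : sgraph) (k : nat) : bool :=
  [exists f : {ffun G -> 'I_k}, [forall x, forall y, adj x y ==> (f x != f y)]].

Lemma properly_colourable_ex (G : sgraph) : exists k, properly_colourable G k.
Proof.
exists #|G|; apply/existsP; exists [ffun x => enum_rank x].
apply/forallP => x; apply/forallP => y; apply/implyP => xy; rewrite !ffunE.
by apply/eqP => /enum_rank_inj exy; rewrite exy adj_irrefl in xy.
Qed.

Definition chromatic_number (G : sgraph) : nat :=
  ex_minn (properly_colourable_ex G).

Definition induced_adj (G : sgraph) (S : {set G}) : rel G :=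
  [rel x y | [&& x \in S, y \in S & adj x y]].

(* Vertex sets of the connected components of the subgraph induced by [S]. *)
Definition components (G : sgraph) (S : {set G}) : {set {set G}} :=
  equivalence_partition (connect (induced_adj S)) S.

Definition monochromatic_component (G : sgraph) (k : nat)
    (f : {ffun G -> 'I_k}) (C : {set G}) : Prop :=
  exists i : 'I_k, C \in components [set x | f x == i].

Definition max_degree_in (G : sgraph) (C : {set G}) : nat :=
  (\max_(x in C) #|[set y in C | adj x y]|)%N.

Definition has_defect (G : sgraph) (k : nat) (f : {ffun G -> 'I_k}) (d : nat) :=
  forall C, monochromatic_component f C -> (max_degree_in C <= d)%N.

Definition has_clustering (G : sgraph) (k : nat) (f : {ffun G -> 'I_k})
    (c : nat) :=
  forall C, monochromatic_component f C -> (#|C| <= c)%N.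

(* Graph classes are plain predicates because the universe of [set] lies below
   that of [finType], so that [set sgraph] does not typecheck. *)
Definition triangle_free_circumference_le (k : nat) (G : sgraph) : Prop :=
  triangle_free G /\ (circumference G <= k)%N.

Section GraphClass.
Local Open Scope classical_set_scope.
Local Open Scope ring_scope.
Variables (R : realType) (A : sgraph -> Prop).

(* The parameters of a graph class are extended reals, +oo meaning "unbounded":
   a supremum of a nonempty set of naturals is its maximum, or +oo if there is
   none; an infimum of a set of naturals is its minimum, or +oo if the set is
   empty. *)

Definition class_chromatic_number : \bar R :=
  ereal_sup [set (n%:R)%:E | n in [set n : nat |
    exists2 G : sgraph, A G & chromatic_number G = n]].

Definition class_defective_chromatic_number : \bar R :=
  ereal_inf [set (k%:R)%:E | k in [set k : nat |
    exists d : nat, forall G : sgraph, A G ->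
      exists f : {ffun G -> 'I_k}, has_defect f d]].

Definition class_clustered_chromatic_number : \bar R :=
  ereal_inf [set (k%:R)%:E | k in [set k : nat |
    exists c : nat, forall G : sgraph, A G ->
      exists f : {ffun G -> 'I_k}, has_clustering f c]].

End GraphClass.

(* Main.v *)
Require Import Defs.
From mathcomp Require Import all_boot boolp zify.

(** A graph whose edges join a word to some of its prefixes, all words having
length at most [n], has no path with [2 ^ n.+1] vertices; hence it suffices to
find triangle-free graphs of this kind, with [n] quadratic in the number [m] of
colours, that are not [m]-colourable with defect [d].  This is an on-line
colouring game: each round presents a vertex attached to an independent set [T]
of earlier vertices, and since every presented vertex exists in more than
[d * n] copies, defect [d] lets us assume that its colour is absent from [T].
Once a colour has been used [m] times it is full, and from then on [T] contains,
for every full colour, one vertex of that colour, chosen outside all the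
previous sets [T].  Such a [T] is independent, because a presented vertex is
adjacent only to members of an earlier [T].  There are at most [m] changes of
[T], so that a full colour always has a fresh vertex left, and no colour is used
more than [m] times, so that the colours run out within [m * m + 1] rounds. *)

Set Implicit Arguments.
Unset Strict Implicit.
Unset Printing Implicit Defensive.

(** * The presenter's strategy in the colouring game *)

(* A word is a node of the game tree: the prefix of length [i.+1] is the vertex
   presented in round [i], its last letter [(T, q)] recording the rounds [T] it
   is attached to and the index [q] of the copy. *)
Section Strategy.
Variables (n m : nat) (Q : finType).
Local Notation letter := ({set 'I_n} * Q)%type.

Definition label (w : seq letter) (i : nat) : {set 'I_n} :=
  nth set0 (unzip1 w) i.

(* Independence of [T], up to edges absent from the graph because the label
   producing them is not itself independent. *)
Definition unlinked (w : seq letter) (T : {set 'I_n}) : bool :=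
  [forall i in T, forall j in T, i \notin label w j].

Lemma unlinkedP w (T : {set 'I_n}) :
  reflect {in T &, forall i j : 'I_n, i \notin label w j} (unlinked w T).
Proof.
apply: (iffP forall_inP) => [H i j iT jT|H i iT].
  exact: (forall_inP (H i iT)).
by apply/forall_inP => j; exact: H.
Qed.

Lemma label_rcons w T q i :
  label (rcons w (T, q)) i =
  if i < size w then label w i else if i == size w then T else set0.
Proof. by rewrite /label /unzip1 map_rcons nth_rcons size_map. Qed.

Lemma label_default w i : size w <= i -> label w i = set0.
Proof. by move=> wi; rewrite /label nth_default // size_map. Qed.

Lemma label_take w i j : i < j -> label (take j w) i = label w i.
Proof. by move=> ij; rewrite /label /unzip1 map_take nth_take. Qed.

Variable F : seq letter -> 'I_m.

Definition positions w (c : 'I_m) : {set 'I_n} :=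
  [set i : 'I_n | (i < size w) && (F (take i.+1 w) == c)].

Definition full_colours w : {set 'I_m} := [set c | m <= #|positions w c|].

Definition used w (T : {set 'I_n}) : {set 'I_n} :=
  T :|: \bigcup_(i < n) label w i.

(** Invariant of the game, with [T] the set to present next. The bound [used_le] counts the changes
    of [T]: each comes with a newly full colour and uses at most one more round of every colour. *)
Record presentable w (T : {set 'I_n}) : Prop := Presentable {
  used_lt : {in used w T, forall i : 'I_n, i < size w};
  unlinked_T : unlinked w T;
  full_sub : {in full_colours w,
                forall c, exists2 i, i \in T & F (take i.+1 w) = c};
  positions_le : forall c, #|positions w c| <= m;
  used_le : forall c, #|positions w c :&: used w T| <= #|full_colours w| }.

Lemma size_presentable w T : size w <= n -> presentable w T -> size w <= m * m.
Proof.
move=> wn pT.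
have -> : size w = \sum_(c < m) #|positions w c|.
  rewrite -{1}(minn_idPl wn) -[minn _ _]card_ord -sum1_card.
  rewrite (eq_bigr (fun c =>
    \sum_(i < n | (i < size w) && (F (take i.+1 w) == c)) 1)); last first.
    by move=> c _; rewrite -sum1_card; apply: eq_bigl => i; rewrite inE.
  rewrite -(partition_big (fun i : 'I_n => F (take i.+1 w)) predT) //.
  by rewrite !sum1_card !card_ord (minn_idPl wn) -[LHS]card_ord -!sum1_card
             (big_ord_widen _ (fun=> 1) wn).
apply: leq_trans (leq_sum _ (fun c _ => positions_le pT c)) _.
by rewrite sum_nat_const card_ord.
Qed.

Lemma take_rcons_lt (w : seq letter) a i :
  i < size w -> take i.+1 (rcons w a) = take i.+1 w.
Proof. by move=> iw; rewrite -cats1 takel_cat. Qed.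

Lemma presentable_rcons w T q : size w < n -> presentable w T ->
    {in T, forall i : 'I_n, F (rcons w (T, q)) != F (take i.+1 w)} ->
  exists T', presentable (rcons w (T, q)) T'.
Proof.
move=> wn [used_w TU full_w pos_w used_m] new.
set w' := rcons w (T, q); pose c0 := F w'; pose k := Ordinal wn.
have w'S : size w' = (size w).+1 by rewrite size_rcons.
have take_w' (i : nat) : i < size w -> take i.+1 w' = take i.+1 w
  by exact: take_rcons_lt.
have take_k : take k.+1 w' = w' by rewrite take_oversize // w'S.
have k_used : k \notin used w T
  by apply/negP => /used_w; rewrite ltnn.
have T_lt i : i \in T -> i < size w by move=> iT; apply: used_w; rewrite inE iT.
have posE c : positions w' c = positions w c :|: [set i in [set k] | c0 == c].
  apply/setP => i; rewrite !inE w'S ltnS; have [->|ik] := eqVneq i k.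
    by rewrite leqnn ltnn take_k.
  rewrite leq_eqVlt (negbTE (_ : i != size w :> nat)) //= orbF.
  by case: ltnP => //= iw; rewrite take_w'.
have labels_w' : \bigcup_(i < n) label w' i \subset used w T.
  apply/bigcupsP => i _; rewrite label_rcons; case: ifP => _.
    by apply/subsetU/orP; right; exact: bigcup_sup.
  by case: ifP => _; rewrite ?sub0set // subsetUl.
(* [T] meets every full colour, and the new colour is absent from [T]. *)
have c0_notfull : c0 \notin full_colours w.
  by apply/negP => /full_w[i /new/eqP + /esym].
have pos_used c : positions w' c :&: used w T = positions w c :&: used w T.
  rewrite posE setIUl; apply/setUidPl/subsetP => i.
  rewrite !inE => /andP[/andP[/eqP->]].
  by move=> _ kU; move: k_used; rewrite !inE kU.
have pos_c0 : positions w' c0 = k |: positions w c0.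
  rewrite posE setUC; congr (_ :|: _).
  by apply/setP => i; rewrite !inE eqxx andbT.
have pos_neq c : c != c0 -> positions w' c = positions w c.
  move=> cc0; rewrite posE; apply/setUidPl/subsetP => i; rewrite !inE.
  by rewrite [c0 == c]eq_sym (negbTE cc0) andbF.
have card_c0 : #|positions w' c0| = #|positions w c0|.+1.
  by rewrite pos_c0 cardsU1 !inE ltnn.
have pos_w' c : #|positions w' c| <= m.
  have [->|cc0] := eqVneq c c0; last by rewrite pos_neq.
  by rewrite card_c0 ltnNge; move: c0_notfull; rewrite inE.
(* Only [c0] can have become full; [T] is replaced exactly when it has. *)
have [full0|nfull0] := boolP (c0 \in full_colours w').
- have fullE : full_colours w' = c0 |: full_colours w.
    apply/setP => c; rewrite in_setU1.
    have [->|cc0] := eqVneq c c0; first by rewrite full0.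
    by rewrite !inE pos_neq.
  have cardfull : #|full_colours w'| = #|full_colours w|.+1.
    by rewrite fullE cardsU1 c0_notfull.
  pose fresh c := [pick j in positions w' c :\: used w T].
  pose T' := [set i : 'I_n | (F (take i.+1 w') \in full_colours w') &&
                             (fresh (F (take i.+1 w')) == Some i)].
  have T'P i : i \in T' -> (i < size w') && (i \notin used w T).
    rewrite inE => /andP[_]; rewrite /fresh; case: pickP => // j + /eqP[<-].
    by rewrite !inE => /andP[-> /andP[->]].
  have used_T' : used w' T' \subset T' :|: used w T by rewrite setUS.
  exists T'; split=> //.
  + move=> i /(subsetP used_T') /setUP[/T'P/andP[]//|/used_w iw].
    by rewrite w'S ltnS ltnW.
  (* The labels of [w'] contain only used rounds, and [T'] avoids these. *)
  + apply/unlinkedP => i j /T'P/andP[_ iU] _; apply: contra iU => iL.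
    have [jw'|jw'] := ltnP j (size w'); last by rewrite label_default // inE in iL.
    by apply: (subsetP labels_w'); apply/bigcupP; exists j.
  + move=> c cfull.
    suff [i] : exists i, i \in positions w' c :\: used w T.
      move=> iP.
      have : exists2 j, fresh c = Some j & j \in positions w' c :\: used w T.
        by rewrite /fresh; case: pickP => [j jP|/(_ i)]; [exists j|rewrite iP].
      case=> j fj; rewrite !inE => /andP[_ /andP[_ /eqP jc]].
      by exists j => //; rewrite inE jc cfull fj /=.
    (* At least [m] rounds have colour [c]; at most [#|full_colours w|] of them are used, which is
       less than [#|full_colours w'| <= m]. *)
    apply/set0Pn; rewrite -card_gt0 cardsD subn_gt0 pos_used.
    apply: leq_ltn_trans (used_m c) _; rewrite -cardfull.
    apply: leq_trans (max_card _) _; rewrite card_ord.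
    by move: cfull; rewrite inE.
  (* [T'] has at most one round of each colour, matching the one new full colour. *)
  + move=> c; rewrite cardfull -addn1.
    apply: (@leq_trans #|(positions w c :&: used w T) :|: (positions w' c :&: T')|).
      by rewrite -pos_used -setIUr setUC subset_leq_card // setIS.
    rewrite cardsU; apply: leq_trans (leq_subr _ _) _; apply: leq_add => //.
    apply/card_le1_eqP => i j; rewrite !inE.
    move=> /and3P[/andP[_ /eqP ic] _ /eqP]; rewrite ic => fi.
    by move=> /and3P[/andP[_ /eqP jc] _ /eqP]; rewrite jc fi => -[].
- have fullE : full_colours w' = full_colours w.
    apply/setP => c.
    have [->|cc0] := eqVneq c c0; last by rewrite !inE pos_neq.
    by rewrite (negbTE nfull0) (negbTE c0_notfull).
  have usedE : used w' T \subset used w T by rewrite subUset subsetUl.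
  exists T; split=> //.
  + by move=> i /(subsetP usedE)/used_w iw; rewrite w'S ltnS ltnW.
  + apply/unlinkedP => i j iT jT; rewrite label_rcons T_lt //.
    exact: (unlinkedP _ _ TU).
  + rewrite fullE => c /full_w[i iT <-]; exists i => //.
    by rewrite take_w' // T_lt.
  + move=> c; rewrite fullE; apply: leq_trans (used_m c).
    by rewrite -pos_used subset_leq_card // setIS.
Qed.

(** If some copy always avoided the colours on [T], the invariant would survive [(m * m).+1] rounds,
    against [size_presentable]. *)
Lemma forced_repetition : m * m < n ->
  exists w (T : {set 'I_n}), [/\ size w < n, unlinked w T,
    {in T, forall i : 'I_n, i < size w} &
    forall q, exists2 i : 'I_n, i \in T & F (rcons w (T, q)) = F (take i.+1 w)].
Proof.
move=> mn; apply: contrapT => H.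
suff [w [T [ws wT]]] : exists w T, size w = (m * m).+1 /\ presentable w T.
  by have := size_presentable _ wT; rewrite ws ltnn => /(_ mn).
have: (m * m).+1 <= n by [].
elim: (m * m).+1 => [_|k IH kn].
  exists [::], set0; split=> //.
  have pos0 c : positions [::] c = set0 by apply/setP => i; rewrite !inE.
  have used0 : used [::] set0 = set0.
    by rewrite /used set0U big1 // => i _; rewrite label_default.
  split.
  - by move=> i; rewrite used0 inE.
  - by apply/unlinkedP => i; rewrite inE.
  (* A colour [c : 'I_m] forces [0 < m], so no colour is full at the start. *)
  - by move=> c; rewrite inE pos0 cards0 leqNgt
                         (leq_ltn_trans _ (ltn_ord c)).
  - by move=> c; rewrite pos0 cards0.
  - by move=> c; rewrite pos0 set0I cards0.
have [w [T [wk wT]]] := IH (ltnW kn).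
have [q qP] : exists q,
    {in T, forall i : 'I_n, F (rcons w (T, q)) != F (take i.+1 w)}.
  apply: contrapT => nq; apply: H; exists w, T; split.
  - by rewrite wk.
  - exact: unlinked_T wT.
  - by move=> i iT; apply: (used_lt wT); rewrite inE iT.
  - move=> q; apply: contrapT => nqi; apply: nq; exists q => i iT.
    by apply/eqP => Fi; apply: nqi; exists i.
have [|T' wT'] := presentable_rcons _ wT qP; first by rewrite wk.
by exists (rcons w (T, q)), T'; rewrite size_rcons wk.
Qed.

End Strategy.

(** * Paths of prefix-comparable words *)

Lemma sorted_take_eq (A : eqType) (e : rel (seq A)) h p :
    (forall s t, e s t -> h <= size s -> h <= size t -> take h s = take h t) ->
    sorted e p -> all (fun s => h <= size s) p ->
  {in p &, forall s t, take h s = take h t}.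
Proof.
move=> e_take; case: p => [|x p] /= exp; first by move=> _ s t; rewrite in_nil.
have takeE y q : path e y q -> all (fun s => h <= size s) (y :: q) ->
    {in y :: q, forall s, take h s = take h y}.
  elim: q y => [|z q IH] y /=; first by move=> _ _ s; rewrite inE => /eqP->.
  move=> /andP[yz zq] /and3P[hy hz hq] s; rewrite inE => /predU1P[->//|sq].
  by rewrite (e_take _ _ yz) // (IH z) //= hz.
by move=> hp s t sp tp; rewrite (takeE x p) // [RHS](takeE x p).
Qed.

(** A treedepth bound: the lengths take at most [k] values, and removing the only word of least
    allowed length leaves two paths with one value fewer. *)
Lemma size_uniq_path_lt (A : eqType) (e : rel (seq A)) n k p :
    (forall h s t, e s t -> h <= size s -> h <= size t -> take h s = take h t) ->
    sorted e p -> uniq p -> all (fun s => (n < size s + k) && (size s <= n)) p ->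
  size p < 2 ^ k.
Proof.
move=> e_take; elim: k p => [|k IH] p ep up /allP pn.
  case: p pn {ep up} => // s p /(_ s (mem_head _ _)).
  by rewrite addn0 ltnNge => /andP[/negP].
have hp s : s \in p -> n - k <= size s <= n.
  by move=> /pn; rewrite addnS ltnS leq_subLR addnC.
have hpk s : s \in p -> size s != n - k -> (n < size s + k) && (size s <= n).
  by move=> /hp /andP[hs ->] sn; rewrite andbT; lia.
have [/hasP[s sp /eqP sn]|/hasPn pnk] :=
  boolP (has (fun s => size s == n - k) p); last first.
  apply: leq_trans (IH p ep up _) _; last by rewrite leq_exp2l.
  by apply/allP => s sp; apply: hpk => //; exact: pnk.
(* All the words share their prefix of length [n - k], so at most one of them
   has this length. *)
have short t : t \in p -> t != s -> (n < size t + k) && (size t <= n).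
  move=> tp ts; apply: hpk => //; apply: contraNneq ts => tn.
  rewrite -[t]take_size -[s]take_size tn sn; apply/eqP.
  apply: (sorted_take_eq (e_take _) ep) => //.
  by apply/allP => u /hp /andP[].
case/splitPr: sp ep up short => p1 p2 ep up short.
have /cat_sorted2[ep1 /path_sorted ep2] := ep.
move: up; rewrite cat_uniq /= => /and3P[up1 /norP[sp1 _] /andP[sp2 up2]].
rewrite size_cat expnS mul2n -addnn -addSn.
apply: leq_add; apply: IH => //; apply/allP => t tp; apply: short.
- by rewrite mem_cat tp.
- by apply: contraNneq sp1 => <-.
- by rewrite mem_cat inE tp !orbT.
- by apply: contraNneq sp2 => <-.
Qed.

(** * The game graph and its defective colourings *)

Lemma has_defect_degree_le (G : sgraph) m (f : {ffun G -> 'I_m}) d (x : G) :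
  has_defect f d -> #|[set y | adj x y & f y == f x]| <= d.
Proof.
move=> fd; pose S := [set y | f y == f x].
pose C := [set y in S | connect (induced_adj S) x y].
have xS : x \in S by rewrite inE.
have CS : C \in components S by apply/imsetP; exists x.
have /fd : monochromatic_component f C by exists (f x).
apply: leq_trans; rewrite /max_degree_in.
have xC : x \in C by rewrite !inE eqxx connect0.
apply: leq_trans (leq_bigmax_cond _ xC); apply/subset_leq_card/subsetP => y.
rewrite !inE => /andP[xy yx]; rewrite xy yx andbT /= connect1 //.
by rewrite /induced_adj /= !inE eqxx yx.
Qed.

Section GameGraph.
Variables (n : nat) (Q : finType).
Local Notation letter := ({set 'I_n} * Q)%type.

Definition top_label (t : seq letter) : {set 'I_n} := label t (size t).-1.

(** Here [s] is an earlier vertex to which [t] is attached. A top label that is not independent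
    gives no edge, and the empty word is isolated. *)
Definition link (s t : seq letter) : bool :=
  unlinked t (top_label t) &&
  [exists i in top_label t, (i.+1 < size t) && (s == take i.+1 t)].

Lemma linkP s t :
  reflect (unlinked t (top_label t) /\ exists i : 'I_n,
             [/\ i \in top_label t, i.+1 < size t & s = take i.+1 t])
          (link s t).
Proof.
apply: (iffP andP) => -[tU].
  by move=> /exists_inP[i iT /andP[it /eqP->]]; split=> //; exists i.
move=> [i [iT it ->]]; split=> //; apply/exists_inP; exists i => //.
by rewrite it eqxx.
Qed.

Lemma size_link s t : link s t -> size s < size t.
Proof. by move=> /linkP[_ [i [_ it ->]]]; rewrite size_takel // ltnW. Qed.

(** Otherwise the rounds of [s] and [t] both lie in the top label of [u], which is independent,
    although the round of [s] lies in the label of [t]. *)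
Lemma link_triangle s t u : link s t -> link t u -> ~~ link s u.
Proof.
move=> /linkP[_ [i [iT it ->]]] /linkP[uU [j [jT ju tE]]].
apply/negP => /linkP[_ [i' [i'T i'u]]].
have tS : size t = j.+1 by rewrite tE size_takel // ltnW.
rewrite tE take_takel; last by rewrite -tS ltnW.
move=> /(congr1 size); rewrite !size_takel ?(ltnW i'u) //; last first.
  by rewrite (leq_trans (ltnW it)) // tS ltnW.
move=> [] /val_inj ii'; rewrite -ii' in i'T.
have := unlinkedP _ _ uU _ _ i'T jT.
by move: iT; rewrite /top_label tS /= tE label_take // => ->.
Qed.

Definition link_sym : rel (seq letter) := [rel s t | link s t || link t s].

Lemma take_link_sym h s t :
  link_sym s t -> h <= size s -> h <= size t -> take h s = take h t.
Proof.
have takeE u v : link u v -> h <= size u -> take h u = take h v.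
  move=> /linkP[_ [i [_ it ->]]]; rewrite size_takel ?(ltnW it) // => hi.
  by rewrite take_takel.
by move=> /orP[st|ts] hs ht; [exact: takeE|apply/esym/takeE].
Qed.

Definition game_adj : rel (n.-bseq letter) := relpre val link_sym.

Lemma game_adj_sym : symmetric game_adj.
Proof. by move=> s t; exact: orbC. Qed.

Lemma game_adj_irrefl : irreflexive game_adj.
Proof.
by move=> s; apply/negP; rewrite [game_adj s s]orbb => /size_link; rewrite ltnn.
Qed.

Definition game_graph := SGraph game_adj_sym game_adj_irrefl.

Lemma triangle_free_game_graph : triangle_free game_graph.
Proof.
apply/forallP => s; apply/forallP => t; apply/forallP => u; apply/negP.
(* Of the eight orientations of a triangle, two are cyclic and contradict the growth of length; the
   other six are transitive. *)
have cyc (a b c : seq letter) : link a b -> link b c -> link c a -> False.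
  move=> /size_link ab /size_link bc /size_link ca.
  by have := ltn_trans (ltn_trans ab bc) ca; rewrite ltnn.
have tri (a b c : seq letter) : link a b -> link b c -> link a c -> False.
  by move=> ab bc; apply/negP/(link_triangle ab bc).
case/and3P => /orP[st|ts] /orP[tu|ut] /orP[us|su].
- exact: cyc st tu us.
- exact: tri st tu su.
- exact: tri us st ut.
- exact: tri su ut st.
- exact: tri tu us ts.
- exact: tri ts su tu.
- exact: tri ut ts us.
- exact: cyc su ut ts.
Qed.

(** A cycle without its closing edge is a path, and the lengths [0] to [n] are [n.+1] values. *)
Lemma circumference_game_graph : circumference game_graph <= 2 ^ n.+1.
Proof.
rewrite /circumference; case: ifP => _; first by rewrite -[2]expn1 leq_exp2l.
apply/bigmax_leqP => i /andP[_ /existsP[c /andP[cc uc]]].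
rewrite -(size_tuple c) -(size_map val) ltnW //.
apply: (@size_uniq_path_lt _ link_sym n); first exact: take_link_sym.
- rewrite sorted_map; move: cc; case: (tval c) => //= x p.
  by rewrite rcons_path => /andP[].
- by rewrite map_inj_uniq //; exact: val_inj.
- apply/allP => _ /mapP[s _ ->]; rewrite size_bseq andbT.
  by rewrite addnS ltnS leq_addl.
Qed.

Lemma game_graph_not_defective m (f : {ffun game_graph -> 'I_m}) d :
  m * m < n -> d * n < #|Q| -> ~ has_defect f d.
Proof.
(* Words longer than [n] get a default colour, which is harmless since the repetition found below
   involves only words of length at most [n]. *)
move=> mn dQ fd; pose F s := f (insub_bseq n s).
have insubK (s : seq letter) : size s <= n -> val (insub_bseq n s) = s.
  by move=> sn; rewrite /insub_bseq insubdK.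
have [w [T [wn wT T_lt qP]]] := forced_repetition F mn.
(* The copies coloured like the vertex of round [i]; for [i] in [T] they are neighbours of that
   vertex. *)
pose A (i : 'I_n) := [set q | F (rcons w (T, q)) == F (take i.+1 w)].
have A_le (i : 'I_n) : i \in T -> #|A i| <= d.
  move=> iT; have := has_defect_degree_le (insub_bseq n (take i.+1 w) : game_graph) fd.
  apply: leq_trans.
  have wqn q : size (rcons w (T, q)) <= n by rewrite size_rcons.
  have inj : injective (fun q => insub_bseq n (rcons w (T, q))).
    by move=> q r /(congr1 val); rewrite !insubK // => /rcons_inj[].
  rewrite -(card_imset _ inj); apply/subset_leq_card/subsetP => _ /imsetP[q + ->].
  rewrite !inE => ->; rewrite andbT /=; apply/orP; left.
  have topE : top_label (rcons w (T, q)) = T.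
    by rewrite /top_label size_rcons label_rcons ltnn eqxx.
  rewrite !insubK //; last by rewrite size_take_min geq_min (ltnW wn) orbT.
  apply/linkP; rewrite topE; split.
    apply/unlinkedP => a b aT bT; rewrite label_rcons T_lt //.
    exact: (unlinkedP _ _ wT).
  by exists i; rewrite size_rcons ltnS T_lt // take_rcons_lt // T_lt.
(* Every copy repeats a colour of [T], so [#|Q| <= d * #|T| <= d * n]. *)
have: #|Q| <= \sum_(i in T) #|A i|.
  rewrite (eq_bigr (fun i => \sum_q (q \in A i))); last first.
    by move=> i _; rewrite -sum1_card big_mkcond.
  rewrite exchange_big -sum1_card; apply: leq_sum => q _.
  have [i iT Fi] := qP q.
  by rewrite (bigD1 i) //= inE Fi eqxx.
apply/negP; rewrite -ltnNge; apply: leq_ltn_trans dQ.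
apply: leq_trans (leq_sum _ A_le) _; rewrite sum_nat_const mulnC.
by rewrite leq_mul2l -[n in _ <= n]card_ord max_card orbT.
Qed.

End GameGraph.

(** * From single graphs to the three class parameters *)

Lemma triangle_free_not_defective K d : exists G : sgraph,
  [/\ triangle_free G, circumference G <= 2 ^ (K * K).+2 &
      forall m (f : {ffun G -> 'I_m}), m <= K -> ~ has_defect f d].
Proof.
(* With [n = (K * K).+1], one graph serves all [m <= K]; it has [d * n + 1] copies. *)
exists (game_graph (K * K).+1 'I_(d * (K * K).+1).+1); split.
- exact: triangle_free_game_graph.
- exact: circumference_game_graph.
- move=> m f mK; apply: game_graph_not_defective; last by rewrite card_ord.
  by rewrite ltnS leq_mul.
Qed.

Lemma has_clustering_defect (G : sgraph) m (f : {ffun G -> 'I_m}) c :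
  has_clustering f c -> has_defect f c.
Proof.
move=> fc C /fc; apply: leq_trans; apply/bigmax_leqP => x _.
by apply/subset_leq_card/subsetP => y; rewrite inE => /andP[].
Qed.

Lemma properly_colourable_defect (G : sgraph) m :
  properly_colourable G m -> exists f : {ffun G -> 'I_m}, has_defect f 0.
Proof.
move=> /existsP[f /forallP fP]; exists f => C [i /imsetP[x xS CE]].
have Ci y : y \in C -> f y = i by rewrite CE !inE => /andP[/eqP].
apply/bigmax_leqP => y yC; rewrite leqn0 cards_eq0; apply/eqP/setP => z.
rewrite !inE; apply/negP => /andP[zC yz].
by have /forallP/(_ z)/implyP/(_ yz)/eqP := fP y; rewrite !Ci.
Qed.

(* Imported only here because [all_classical] shadows the names of [finset]. *)
From mathcomp Require Import all_order all_algebra.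
From mathcomp Require Import all_classical all_reals all_analysis.
From mathcomp Require Import lra.
Import Order.TTheory GRing.Theory Num.Theory.
Local Open Scope ring_scope.

(** The constant comes from [ln k <= K ^ 2 + 2 <= (2 * K) ^ 2], using [ln 2 <= 1] and [1 <= K], the
    latter because [4 <= k]. *)
Lemma sqrt_ln_le (R : realType) (k K : nat) : (4 <= k < 2 ^ (K * K).+2)%N ->
  2^-1 * Num.sqrt (ln (k%:R : R)) <= K%:R.
Proof.
case/andP=> k4 kK; have k0 : 0 < k%:R :> R by rewrite ltr0n; lia.
have K1 : (0 < K)%N by case: K kK => //; lia.
have ln2 : ln (2 : R) <= 1 by rewrite (le_ln1Dx (x := 1)) ?ltrN10//; lra.
have : ln (k%:R : R) <= (2 * K%:R) ^+ 2.
  apply: (@le_trans _ _ (ln ((2 : R) ^+ (K * K).+2))).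
    by rewrite ler_ln ?posrE ?exprn_gt0 // -natrX ler_nat ltnW.
  rewrite lnXn // -[ln 2 *+ _]mulr_natl.
  apply: (@le_trans _ _ ((K * K).+2%:R * 1)); first by rewrite ler_wpM2l.
  by rewrite mulr1 -natrM -natrX ler_nat; nia.
move=> /ler_wsqrtr; rewrite sqrtr_sqr ger0_norm; last by rewrite -natrM.
by move: (Num.sqrt _) => x; lra.
Qed.

Lemma triangle_free_circumference_le_not_defective k K d :
    (2 ^ (K * K).+2 <= k)%N ->
  exists2 G, triangle_free_circumference_le k G &
    forall m (f : {ffun G -> 'I_m}), (m <= K)%N -> ~ has_defect f d.
Proof.
move=> kK; have [G [tG cG nG]] := triangle_free_not_defective K d.
by exists G => //; split=> //; exact: leq_trans cG kK.
Qed.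

Lemma sqrt_ln_le_class_chromatic_number (R : realType) k : (4 <= k)%N ->
  ((2^-1 * Num.sqrt (ln (k%:R : R)))%:E <=
     class_chromatic_number R (triangle_free_circumference_le k))%E.
Proof.
move=> k4; have exK : exists K, (k < 2 ^ (K * K).+2)%N.
  exists k; apply: ltn_trans (ltn_expl k (ltnSn 1)) _.
  by rewrite ltn_exp2l //; nia.
(* The least exponent parameter is nonzero as [4 <= k]. Calling it [K.+1], minimality puts a graph
   that defeats [K] colours into the class. *)
case: (ex_minnP exK) => -[|K] kK K_min; first by move: kK; rewrite ltnNge k4.
have : (2 ^ (K * K).+2 <= k)%N.
  by rewrite leqNgt; apply/negP => /K_min; rewrite ltnn.
move=> /(triangle_free_circumference_le_not_defective 0)[G kG nG].
apply: (@le_trans _ _ (chromatic_number G)%:R%:E).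
  rewrite lee_fin (le_trans (@sqrt_ln_le R k K.+1 _)) ?k4 // ler_nat.
  rewrite /chromatic_number.
  case: ex_minnP => m /properly_colourable_defect[f fd] _.
  by rewrite ltnNge; apply/negP => /nG/(_ fd).
by apply: ereal_sup_ubound; exists (chromatic_number G) => //; exists G.
Qed.

Lemma sqrt_ln_le_class_defective_chromatic_number (R : realType) k :
    (4 <= k)%N ->
  ((2^-1 * Num.sqrt (ln (k%:R : R)))%:E <=
     class_defective_chromatic_number R (triangle_free_circumference_le k))%E.
Proof.
(* If [2 ^ (K * K).+2 <= k], some graph of the class would defeat [K] colours with defect [d]. *)
move=> k4; apply: le_ereal_inf_tmp => _ [K [d Kd] <-].
rewrite lee_fin sqrt_ln_le // k4 ltnNge; apply/negP.
move=> /(triangle_free_circumference_le_not_defective d)[G kG nG].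
by have [f fd] := Kd G kG; exact: (nG K f).
Qed.

Lemma class_defective_le_clustered (R : realType) A :
  (class_defective_chromatic_number R A <=
     class_clustered_chromatic_number R A)%E.
Proof.
apply: ereal_inf_le_tmp => _ [K [c Kc] <-]; exists K => //; exists c => G AG.
by have [f /has_clustering_defect fc] := Kc G AG; exists f.
Qed.

Theorem corollary12 (R : realType) :
  exists c : R, 0 < c /\ exists k0 : nat, forall k : nat, (k0 <= k)%N ->
    let bound := (c * Num.sqrt (ln (k%:R : R)))%:E in
    [/\ (bound <= class_chromatic_number R (triangle_free_circumference_le k))%E,
        (bound <= class_defective_chromatic_number R
                    (triangle_free_circumference_le k))%E &
        (bound <= class_clustered_chromatic_number R
                    (triangle_free_circumference_le k))%E].
Proof.
exists 2^-1; split; first by rewrite invr_gt0.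
exists 4 => k k4 bound; split.
- exact: sqrt_ln_le_class_chromatic_number.
- exact: sqrt_ln_le_class_defective_chromatic_number.
- apply: le_trans (class_defective_le_clustered _ _).
  exact: sqrt_ln_le_class_defective_chromatic_number.
Qed.
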